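(* Let $\mathscr{P}=(A,b,c)$ be a minimal SISO linear time-invariant system. For every real $k\neq0$, $$\mathcal{S}_{\mathscr{P}}(k)\setminus\{0\}=\left\{-\frac{1}{sk}\;\Big|\; s\in\mathcal{N}_{\mathscr{P}}\setminus\{0\}\right\}.$$
   Context: A SISO system $\mathscr{P}=(A,b,c)$ has $A\in\mathbb{R}^{n\times n}$, $b\in\mathbb{R}^{n\times1}$, $c\in\mathbb{R}^{1\times n}$ and (strictly proper) transfer function $H(s)=c(sI-A)^{-1}b$; minimal means controllable and observable. The synchronization region is $\mathcal{S}_{\mathscr{P}}(k)=\{s\in\mathbb{C}\mid A-skbc\text{ is Hurwitz}\}$, where a square complex matrix is Hurwitz if all its eigenvalues have strictly negative real part. The Nyquist contour is the oriented curve $\gamma:[-\infty,\infty]\to\mathbb{C}$, $\gamma(\omega)=H(i\omega)$, extended by continuity to $\gamma(\pm\infty)=0$. $\mathrm{Ind}_\gamma(s)$ denotes the winding number of $\gamma$ around $s\in\mathbb{C}$ (number of counterclockwise rotations), defined for $s$ not on the curve. If $H$ has poles $i\omega_i$ on the imaginary axis, define $$\gamma_\epsilon(\omega)=\begin{cases}H\bigl(i\omega_i+\epsilon e^{\frac{i\pi}{2\epsilon}(\omega-\omega_i)}\bigr),&|\omega-\omega_i|<\epsilon,\\ H(i\omega),&\text{otherwise},\end{cases}$$ and $\mathrm{Ind}_\gamma(s):=\lim_{\epsilon\to0^+}\mathrm{Ind}_{\gamma_\epsilon}(s)$. The stable Nyquist region is $\mathcal{N}_{\mathscr{P}}=\{s\in\mathbb{C}\mid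 \mathrm{Ind}_\gamma(s)=p^+\}$, where $p^+$ is the number of poles of $H$ (with multiplicity) in the open right half plane; points lying on the curve, where the winding number is undefined, do not belong to $\mathcal{N}_{\mathscr{P}}$. *)

(* Defs.v *)
From HB Require Import structures.
From mathcomp Require Import all_boot all_order all_algebra.
From mathcomp Require Import generic_quotient fraction.
From mathcomp Require Import all_classical all_reals all_analysis.
From mathcomp Require Import complex.

Set Implicit Arguments.
Unset Strict Implicit.
Unset Printing Implicit Defensive.

Import Order.TTheory GRing.Theory Num.Theory.
Import numFieldNormedType.Exports.

Local Open Scope classical_set_scope.
Local Open Scope complex_scope.
Local Open Scope ring_scope.

(* Kalman rank conditions. *)
Definition controllable (R : realType) (n : nat) (A : 'M[R]_n) (b : 'cV[R]_n)
    : Prop :=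
  \rank (\matrix_(i < n, j < n) (A ^+ j *m b) i 0) = n.

Definition observable (R : realType) (n : nat) (A : 'M[R]_n) (c : 'rV[R]_n)
    : Prop :=
  \rank (\matrix_(i < n, j < n) (c *m A ^+ i) 0 j) = n.

Definition minimal (R : realType) (n : nat)
    (A : 'M[R]_n) (b : 'cV[R]_n) (c : 'rV[R]_n) : Prop :=
  controllable A b /\ observable A c.

Definition hurwitz (R : realType) (n : nat) (M : 'M[R[i]]_n) : Prop :=
  forall z : R[i], eigenvalue M z -> complex.Re z < 0.

Definition tocomplex (R : realType) (m n : nat) (M : 'M[R]_(m, n))
    : 'M[R[i]]_(m, n) :=
  map_mx (fun x => x%:C) M.

Definition sync_region (R : realType) (n : nat)
    (A : 'M[R]_n) (b : 'cV[R]_n) (c : 'rV[R]_n) (k : R) : set R[i] :=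
  [set s | hurwitz (tocomplex A - (s * k%:C) *: (tocomplex b *m tocomplex c))].

(* The transfer function is an element of the field C(s) of rational functions,
   so that a common factor of numerator and denominator creates no pole. *)
Definition toratfun (R : realType) (m n : nat) (M : 'M[R]_(m, n))
    : 'M[{fraction {poly R[i]}}]_(m, n) :=
  map_mx (fun x => tofrac (x%:C)%:P) M.

Definition transfer (R : realType) (n : nat)
    (A : 'M[R]_n) (b : 'cV[R]_n) (c : 'rV[R]_n) : {fraction {poly R[i]}} :=
  (toratfun c *m invmx ((tofrac 'X)%:M - toratfun A) *m toratfun b) 0 0.

(* repr picks an arbitrary representative num/den, hence the division by the
   gcd to put it in lowest terms. *)
Definition rat_num (R : realType) (f : {fraction {poly R[i]}}) : {poly R[i]} :=
  let p := frac (repr f) in p.1 %/ gcdp p.1 p.2.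

Definition rat_den (R : realType) (f : {fraction {poly R[i]}}) : {poly R[i]} :=
  let p := frac (repr f) in p.2 %/ gcdp p.1 p.2.

(* Meaningful when z is not a pole of f. *)
Definition rat_eval (R : realType) (f : {fraction {poly R[i]}}) (z : R[i])
    : R[i] :=
  (rat_num f).[z] / (rat_den f).[z].

(* Each pole is repeated according to its multiplicity. *)
Definition poles (R : realType) (f : {fraction {poly R[i]}}) : seq R[i] :=
  sval (closed_field_poly_normal (rat_den f)).

Definition num_unstable_poles (R : realType) (f : {fraction {poly R[i]}})
    : nat :=
  count (fun z : R[i] => 0 < complex.Re z) (poles f).

(* The real numbers w such that iw is a pole. *)
Definition imag_poles (R : realType) (f : {fraction {poly R[i]}}) : seq R :=
  [seq complex.Im z | z <- poles f & complex.Re z == 0].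

Definition expi (R : realType) (t : R) : R[i] := cos t +i* sin t.

(* The extended real line parametrizes a loop based at 0 = f(oo), for f strictly
   proper. *)
Definition nyquist_curve (R : realType) (f : {fraction {poly R[i]}})
    (w : \bar R) : R[i] :=
  match w with
  | EFin x => rat_eval f (0 +i* x)
  | _ => 0
  end.

(* For e small enough, at most one imaginary pole lies within e of a given x,
   so that the choice of the first one in the list is immaterial. *)
Definition indented_curve (R : realType) (f : {fraction {poly R[i]}}) (e : R)
    (w : \bar R) : R[i] :=
  match w with
  | EFin x =>
    match [seq wi <- imag_poles f | `|x - wi| < e] with
    | wi :: _ =>
        rat_eval f ((0 +i* wi) + e%:C * expi (pi / (2 * e) * (x - wi)))
    | [::] => rat_eval f (0 +i* x)
    end
  | _ => 0
  end.

(* theta is a continuous determination, up to both ends of the extended real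
   line, of the argument of g - s. *)
Definition winding_number (R : realType) (g : \bar R -> R[i]) (s : R[i])
    (m : int) : Prop :=
  (forall w, g w != s) /\
  exists theta : \bar R -> R,
    [/\ continuous theta,
        (forall w, g w - s = `|g w - s| * expi (theta w)) &
        theta +oo%E - theta -oo%E = 2 * pi * m%:~R].

(* The index is only partially defined: the limit requires ind e to be the
   winding number of the indented curve for all small e > 0. *)
Definition nyquist_index (R : realType) (f : {fraction {poly R[i]}}) (s : R[i])
    (m : int) : Prop :=
  if imag_poles f is [::] then winding_number (nyquist_curve f) s m
  else exists ind : R -> int,
    (\forall e \near 0^'+, winding_number (indented_curve f e) s (ind e)) /\
    ((ind e)%:~R : R) @[e --> 0^'+] --> (m%:~R : R).

Definition stable_nyquist_region (R : realType) (n : nat)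
    (A : 'M[R]_n) (b : 'cV[R]_n) (c : 'rV[R]_n) : set R[i] :=
  [set s | nyquist_index (transfer A b c) s
             (num_unstable_poles (transfer A b c))%:Z].

(* Main.v *)
Require Import Defs.
From mathcomp Require Import all_boot all_order all_algebra.
From mathcomp Require Import generic_quotient fraction.
From mathcomp Require Import all_classical all_reals all_analysis.
From mathcomp Require Import complex.
From mathcomp Require Import ring lra.
Import Order.TTheory GRing.Theory Num.Theory.
Import numFieldNormedType.Exports.
Local Open Scope classical_set_scope.
Local Open Scope complex_scope.
Local Open Scope ring_scope.

(** Write p for the characteristic polynomial of A and q = c adj(X - A) b, so
    that the transfer function is H = q / p.  The proof has three ingredients.

    Algebra.  The matrix determinant lemma gives
    char_poly (A - t b c) = p + t q ([char_poly_feedback]).  With t = s k and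
    sigma = - 1 / (s k) this polynomial is p - sigma^-1 q, so that s belongs to
    the synchronization region if and only if p - sigma^-1 q has all its roots
    in the open left half plane.  Moreover p and q are coprime when A, b, c is
    minimal ([coprimep_char_poly_transfer_num]), hence H is already in lowest
    terms: its poles are the roots of p, with multiplicity.

    Winding numbers.  Factoring p and p - sigma^-1 q gives
    H(z) - sigma = - sigma * \prod (z - z_j) / \prod (z - p_j), with as many
    factors z - z_j as factors z - p_j.  An argument of H - sigma along the
    indented axis is therefore a signed sum of arguments of the factors z - a,
    each of which is explicit ([arg_along_contour]): it goes from - pi / 2 to
    pi / 2 if a lies to the left of the path, and from 3 pi / 2 to pi / 2 if a
    lies to its right.  Hence the winding number is p+ - z+, where z+ is the
    number of roots of p - sigma^-1 q in the open right half plane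
    ([near_winding_number]).  An intermediate value argument shows that winding
    numbers are unique ([winding_number_uniq]), so the index is p+ if and only
    if z+ = 0.

    The imaginary axis.  The formula needs p - sigma^-1 q not to vanish on the
    axis.  If it vanishes at an imaginary z, then p(z) is nonzero by
    coprimality and H(z) = sigma; the curve goes through sigma for every small
    indentation and sigma has no index ([value_on_axis_no_index]).  So sigma
    lies in the stable Nyquist region if and only if all roots of
    p - sigma^-1 q lie in the open left half plane ([nyquist_criterion]). *)

Set Implicit Arguments.
Unset Strict Implicit.
Unset Printing Implicit Defensive.

(** * Rank one perturbations and the numerator of the transfer function *)

(** The determinant of the block matrix with rows (M, - x) and (y, 1) is
    computed in two ways: clearing y from the right leaves det (M + x y), and
    clearing it from the left by means of adj M leaves the right-hand side, up
    to the factor det M * det (adj M). *)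
Lemma det_rank1_update (D : idomainType) (n : nat) (M : 'M[D]_n)
    (x : 'cV[D]_n) (y : 'rV[D]_n) :
  \det M != 0 -> \det (M + x *m y) = \det M + (y *m \adj M *m x) 0 0.
Proof.
move=> M0; set d := _ + _ 0 0.
pose B := block_mx M (- x) y (1%:M : 'M[_]_1).
have detB : \det B = \det (M + x *m y).
  have -> : B = block_mx (M + x *m y) (- x) 0 1%:M *m block_mx 1%:M 0 y 1%:M.
    by rewrite mulmx_block !(mulmx1, mul1mx, mulmx0, mul0mx, add0r) mulNmx addrK.
  by rewrite det_mulmx det_ublock det_lblock !det1 !mulr1.
pose L := block_mx (\adj M) 0 (- (y *m \adj M)) (\det M)%:M.
have LB : L *m B = block_mx (\det M)%:M (- (\adj M *m x)) 0 d%:M.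
  rewrite mulmx_block mul_adj_mx !(mul0mx, mulmx1) !addr0 mulmxN; congr block_mx.
    by rewrite mulNmx -mulmxA mul_adj_mx mul_mx_scalar mul_scalar_mx addNr.
  rewrite mulNmx mulmxN opprK addrC [X in _ + X]mx11_scalar -raddfD /=.
  by congr (_%:M).
have := congr1 determinant LB.
rewrite det_mulmx det_lblock det_ublock !det_scalar expr1 detB.
rewrite -det_scalar -mul_adj_mx det_mulmx -!mulrA; apply: contra_eq => ne.
have adj0 : \det (\adj M) != 0.
  have : \det (\adj M *m M) != 0 by rewrite mul_adj_mx det_scalar expf_neq0.
  by rewrite det_mulmx mulf_eq0 negb_or => /andP[].
by rewrite (inj_eq (mulfI adj0)) (inj_eq (mulfI M0)).
Qed.

(** The row c adj(X - A), that is, char_poly A times the row c (X - A)^-1. *)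
Definition resolvent_row (F : comNzRingType) (n : nat) (A : 'M[F]_n)
    (c : 'rV[F]_n) : 'rV[{poly F}]_n :=
  map_mx polyC c *m \adj (char_poly_mx A).

(** The numerator of c (X - A)^-1 b over char_poly A, before any
    cancellation. *)
Definition transfer_num (F : comNzRingType) (n : nat) (A : 'M[F]_n)
    (b : 'cV[F]_n) (c : 'rV[F]_n) : {poly F} :=
  (resolvent_row A c *m map_mx polyC b) 0 0.

Lemma char_poly_feedback (F : idomainType) (n : nat) (A : 'M[F]_n)
    (b : 'cV[F]_n) (c : 'rV[F]_n) (t : F) :
  char_poly (A - t *: (b *m c)) = char_poly A + t *: transfer_num A b c.
Proof.
rewrite /char_poly /char_poly_mx.
have -> : 'X%:M - map_mx polyC (A - t *: (b *m c)) =
    char_poly_mx A + (t%:P *: map_mx polyC b) *m map_mx polyC c.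
  by rewrite -scalemxAl map_mxB map_mxZ map_mxM opprB addrA addrAC.
rewrite det_rank1_update; last exact/monic_neq0/char_poly_monic.
by rewrite -scalemxAr mxE mul_polyC.
Qed.

Lemma resolvent_rowM (F : comNzRingType) (n : nat) (A : 'M[F]_n) (c : 'rV[F]_n) :
  resolvent_row A c *m map_mx polyC A =
  'X *: resolvent_row A c - char_poly A *: map_mx polyC c.
Proof.
apply/eqP; rewrite eq_sym subr_eq addrC -subr_eq; apply/eqP.
rewrite -mul_mx_scalar -mulmxBr -/(char_poly_mx A) /resolvent_row -mulmxA.
by rewrite mul_adj_mx mul_mx_scalar.
Qed.

Lemma size_resolvent_row (F : comNzRingType) (n : nat) (A : 'M[F]_n)
  (c : 'rV[F]_n) (v : 'cV[F]_n) :
  (size ((resolvent_row A c *m map_mx polyC v) 0%R 0%R) <= n)%N.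
Proof.
have size_sumC (I : finType) (f : I -> {poly F}) (g : I -> F) m :
    (forall i, size (f i) <= m)%N -> (size (\sum_i f i * (g i)%:P)%R <= m)%N.
  move=> fm; apply: (leq_trans (size_sum _ _ _)); apply/bigmax_leqP => i _.
  by rewrite mulrC mul_polyC (leq_trans (size_scale_leq _ _)).
rewrite mxE; under eq_bigr do rewrite [map_mx _ v _ _]mxE.
apply: (size_sumC) => i; rewrite mxE; under eq_bigr do rewrite mxE mulrC.
apply: (size_sumC) => j; rewrite mxE.
case: n A c v i j => [|n] A c v i j; first by case: i.
rewrite /cofactor -signr_odd mulr_sign.
have -> (b : bool) (q : {poly F}) : size (if b then - q else q) = size q.
  by case: b; rewrite ?size_polyN.
rewrite /determinant; apply: leq_trans (size_sum _ _ _) _.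
apply/bigmax_leqP => s _; rewrite mulr_sign.
have -> (d : bool) (q : {poly F}) : size (if d then - q else q) = size q.
  by case: d; rewrite ?size_polyN.
apply: leq_trans (size_prod_leq _ _) _; rewrite leq_subLR.
rewrite card_ord addnS ltnS addnn -muln2 -[X in (X * 2)%N]card_ord -sum_nat_const.
apply: leq_sum => k _; rewrite !mxE; case: eqP => _.
  by rewrite mulr1n size_XsubC.
rewrite mulr0n sub0r size_polyN.
exact: leq_trans (size_polyC_leq1 _) _.
Qed.

(** Modulo char_poly A, the functional v |-> c adj(X - A) v turns the action of
    A into multiplication by X. *)
Lemma resolvent_row_shift (F : comNzRingType) (n : nat) (A : 'M[F]_n)
    (c : 'rV[F]_n) (v : 'cV[F]_n) :
  (resolvent_row A c *m map_mx polyC (A *m v)) 0 0 =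
  'X * (resolvent_row A c *m map_mx polyC v) 0 0
    - char_poly A * ((c *m v) 0 0)%:P.
Proof.
rewrite map_mxM mulmxA resolvent_rowM mulmxBl -!scalemxAl -map_mxM.
by rewrite !mxE.
Qed.

Lemma resolvent_row_horner (F : fieldType) (n : nat) (A : 'M[F]_n.+1)
    (c : 'rV[F]_n.+1) (v : 'cV[F]_n.+1) (r : {poly F}) :
  char_poly A %| (resolvent_row A c *m map_mx polyC (horner_mx A r *m v)) 0 0
                 - r * (resolvent_row A c *m map_mx polyC v) 0 0.
Proof.
elim/poly_ind: r => [|r a IH].
  by rewrite rmorph0 mul0mx map_mx0 mulmx0 mxE mul0r subr0 dvdp0.
rewrite mulrC rmorphD rmorphM /= horner_mx_X horner_mx_C.
rewrite -[A * _]/(A *m _) mulmxDl -(mulmxA A).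
rewrite map_mxD mulmxDr mxE resolvent_row_shift mul_scalar_mx map_mxZ -scalemxAr.
rewrite [X in _ + X - _]mxE; set q := char_poly A in IH *.
set w := _ 0 0 in IH *; set u := _ 0 0 in IH *; set y := polyC _.
have -> : 'X * w - q * y + a%:P * u - ('X * r + a%:P) * u =
   'X * (w - r * u) + q * - y by ring.
by apply: dvdp_add; [exact: dvdp_mull | exact: dvdp_mulr].
Qed.

(** Let g be the gcd of p = char_poly A and q, and r = p / g.  Then p divides
    X^k r q for all k, hence, modulo p, the polynomial c adj(X - A) A^k r(A) b
    vanishes; its degree being less than n, it is zero.  So c A^k r(A) b = 0
    for all k, and r(A) b = 0 by observability.  If g were not constant, the
    degree of r would be less than n, and this would be a linear relation
    between the columns A^j b of the controllability matrix. *)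
Lemma coprimep_char_poly_transfer_num (F : fieldType) (n : nat) (A : 'M[F]_n)
    (b : 'cV[F]_n) (c : 'rV[F]_n) :
  \rank (\matrix_(i < n, j < n) (A ^+ j *m b) i 0) = n ->
  \rank (\matrix_(i < n, j < n) (c *m A ^+ i) 0 j) = n ->
  coprimep (char_poly A) (transfer_num A b c).
Proof.
case: n A b c => [|n] A b c ctr obs.
  by rewrite /char_poly det_mx00 coprime1p.
set p := char_poly A; set q := transfer_num A b c.
have p0 : p != 0 by exact/monic_neq0/char_poly_monic.
have [r pr] := dvdpP _ _ (dvdp_gcdl p q).
have [s qs] := dvdpP _ _ (dvdp_gcdr p q).
set g := gcdp p q in pr qs *.
have g0 : g != 0 by rewrite gcdp_eq0 negb_and p0.
have r0 : r != 0 by apply: contraNneq p0 => r0; rewrite pr r0 mul0r.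
have rq : p %| r * q by rewrite qs mulrCA -pr dvdp_mull.
rewrite /coprimep -/g eqn_leq size_poly_gt0 g0 andbT leqNgt; apply/negP => g1.
have rn : (size r <= n.+1)%N.
  have := size_mul r0 g0; rewrite -pr size_char_poly.
  by case: (size g) g1 => [|[|m]] //= _;
     rewrite !addnS => -[->]; rewrite leq_addr.
pose w := horner_mx A r *m b.
have phi0 k : (resolvent_row A c *m map_mx polyC (A ^+ k *m w)) 0 0 = 0.
  apply/eqP/negPn/negP => phi0.
  have := resolvent_row_horner A c b ('X^k * r).
  rewrite rmorphM rmorphXn /= horner_mx_X.
  rewrite -[A ^+ k * _]/(_ *m _) -(mulmxA (A ^+ k)) -/w.
  rewrite -mulrA -[(resolvent_row A c *m map_mx polyC b) 0 0]/q.
  rewrite dvdp_subl; last exact: dvdp_mull.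
  move=> pdvd; have := dvdp_leq phi0 pdvd.
  by rewrite size_char_poly ltnNge size_resolvent_row.
have cAw k : (c *m (A ^+ k *m w)) 0 0 = 0.
  have := resolvent_row_shift A c (A ^+ k *m w).
  rewrite (mulmxA A) -[A *m A ^+ k]/(A * _) -exprS !phi0 mulr0 add0r => /esym/eqP.
  by rewrite oppr_eq0 mulf_eq0 (negPf p0) polyC_eq0 => /eqP.
have w0 : w = 0.
  pose O : 'M[F]_n.+1 := \matrix_(i, j) (c *m A ^+ i) 0 j.
  have : w^T *m O^T = 0.
    rewrite -trmx_mul; apply/matrixP => i j; rewrite (ord1 i) [RHS]mxE -(cAw j).
    rewrite mulmxA [LHS]mxE [LHS]mxE [RHS]mxE.
    by apply: eq_bigr => k _; rewrite mxE.
  have : row_free O^T by rewrite -row_leq_rank mxrank_tr obs.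
  by move=> /mulmx_free_eq0 Ofree /eqP; rewrite Ofree => /eqP /(congr1 trmx);
    rewrite trmxK trmx0.
have wE : w = \sum_(j < n.+1) r`_j *: (A ^+ j *m b).
  rewrite /w -{1}(poly_rV_K rn) [rVpoly _]poly_def linear_sum mulmx_suml.
  apply: eq_bigr => j _; rewrite valK mxE linearZ rmorphXn /= horner_mx_X.
  by rewrite -scalemxAl.
pose C : 'M[F]_n.+1 := \matrix_(i, j) (A ^+ j *m b) i 0.
have : (poly_rV r : 'rV[F]_n.+1) *m C^T = 0.
  apply/matrixP => i j; rewrite !mxE.
  have := congr1 (fun M : 'cV[F]_n.+1 => M j 0) wE; rewrite w0 summxE mxE => e.
  rewrite [RHS]e.
  by apply: eq_bigr => k _; rewrite !mxE.
have : row_free C^T by rewrite -row_leq_rank mxrank_tr ctr.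
move=> /mulmx_free_eq0 Ofree /eqP; rewrite Ofree => /eqP /(congr1 (@rVpoly _ _)).
rewrite poly_rV_K // linear0 => /eqP; exact/negP.
Qed.

(** * Arguments of complex numbers *)

Definition is_arg (R : realType) (z : R[i]) (t : R) := z = `|z| * expi t.

Lemma expi0 (R : realType) : expi (0 : R) = 1.
Proof. by rewrite /expi cos0 sin0. Qed.

Lemma expiD (R : realType) (a b : R) : expi (a + b) = expi a * expi b.
Proof.
rewrite /expi cosD sinD; apply/eqP; rewrite eq_complex /=.
by apply/andP; split; apply/eqP; ring.
Qed.

Lemma expiN (R : realType) (a : R) : expi (- a) = (expi a)^-1.
Proof.
by apply/esym/mulr1_eq; rewrite -expiD addrN expi0.
Qed.

Lemma expi_2pi_nat (R : realType) (k : nat) : expi (2 * pi * k%:R : R) = 1.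
Proof.
elim: k => [|k IH]; first by rewrite mulr0 expi0.
rewrite -[k.+1%:R]natr1 mulrDr mulr1 expiD IH mul1r /expi [2 * pi]mulr_natl.
by rewrite cos2pi sin2pi.
Qed.

Lemma is_argM (R : realType) (z w : R[i]) (s t : R) :
  is_arg z s -> is_arg w t -> is_arg (z * w) (s + t).
Proof. by rewrite /is_arg => {1}-> {1}->; rewrite normrM expiD mulrACA. Qed.

Lemma is_argV (R : realType) (z : R[i]) (s : R) : is_arg z s -> is_arg z^-1 (- s).
Proof. by rewrite /is_arg => {1}->; rewrite invfM normfV expiN. Qed.

(** The half-angle formula tan (t / 2) = y / (|z| + x) for z = x + i y: a single
    expression, continuous off the closed negative real half-line. *)
Definition principal_arg (R : realType) (x y : R) : R :=
  2 * atan (y / (Num.sqrt (x ^+ 2 + y ^+ 2) + x)).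

Lemma principal_argP (R : realType) (x y : R) :
  0 < Num.sqrt (x ^+ 2 + y ^+ 2) + x -> is_arg (x +i* y) (principal_arg x y).
Proof.
rewrite /is_arg normc_def /=; set N := Num.sqrt _ => Nx.
have N2 : N ^+ 2 = x ^+ 2 + y ^+ 2 by rewrite sqr_sqrtr // addr_ge0 ?sqr_ge0.
have N0 : 0 < N.
  rewrite lt_neqAle sqrtr_ge0 andbT; apply: contraTneq Nx => N0.
  move: N2; rewrite -N0 expr0n /= => /eqP; rewrite eq_sym paddr_eq0 ?sqr_ge0 //.
  by rewrite sqrf_eq0 => /andP[/eqP-> _]; rewrite addr0 ltxx.
pose t := y / (N + x); rewrite -[principal_arg x y]/(2 * atan t).
have Nx0 := lt0r_neq0 Nx.
have D0 : 1 + t ^+ 2 != 0 by rewrite lt0r_neq0 // ltr_pwDl ?sqr_ge0.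
have c2 : cos (atan t) ^+ 2 = (1 + t ^+ 2)^-1.
  by rewrite cos_atan exprVn sqr_sqrtr // addr_ge0 ?sqr_ge0.
have c0 : cos (atan t) != 0
  by apply: contraNneq D0 => c0; rewrite -invr_eq0 -c2 c0 expr0n.
have s1 : sin (atan t) = t * cos (atan t) by rewrite -{2}[t]atanK /tan divfK.
have y2 : y ^+ 2 = N ^+ 2 - x ^+ 2 by rewrite N2; ring.
have D : (1 + t ^+ 2)^-1 = (N + x) / (2 * N).
  rewrite /t expr_div_n y2; field; rewrite Nx0 (lt0r_neq0 N0) /=.
  have -> : (N + x) ^+ 2 + (N ^+ 2 - x ^+ 2) = 2 * N * (N + x) by ring.
  by rewrite !mulf_neq0 // lt0r_neq0.
have cE : cos (2 * atan t) = x / N.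
  rewrite mulr_natl cos_mulr2n c2 D -mulr_natl; field; exact: lt0r_neq0.
have sE : sin (2 * atan t) = y / N.
  rewrite mulr_natl sin_mulr2n s1 mulrCA -expr2 c2 D -mulr_natl /t.
  by field; rewrite Nx0 lt0r_neq0.
apply/eqP; rewrite eq_complex /expi cE sE /= !mul0r subr0 addr0.
by rewrite ![N * (_ / N)]mulrC !divfK ?lt0r_neq0 // !eqxx.
Qed.

Lemma exists_arg (R : realType) (z : R[i]) : exists t, is_arg z t.
Proof.
case: z => x y; have [xy|xy] := ltP 0 (Num.sqrt (x ^+ 2 + y ^+ 2) + x).
  by exists (principal_arg x y); exact: principal_argP.
(* The formula for the principal argument fails on nonpositive reals only. *)
have xN : `|x| <= Num.sqrt (x ^+ 2 + y ^+ 2).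
  by rewrite -sqrtr_sqr ler_sqrt ?lerDl ?sqr_ge0 ?addr_ge0 ?sqr_ge0.
have x0 : x <= 0 by have := normr_ge0 x; lra.
have /eqP y0 : y == 0.
  rewrite -sqrf_eq0 eq_le sqr_ge0 andbT -(lerD2l (x ^+ 2)) addr0.
  rewrite -[leLHS]sqr_sqrtr ?addr_ge0 ?sqr_ge0 // -[leRHS]sqrrN.
  by rewrite lerXn2r ?nnegrE ?sqrtr_ge0 ?oppr_ge0 //; lra.
exists pi; rewrite /is_arg normc_def /expi cospi sinpi y0 /=.
rewrite expr0n /= addr0 sqrtr_sqr ler0_norm //.
by apply/eqP; rewrite eq_complex /= !mulr0 !mul0r subr0 addr0 mulrN1 opprK !eqxx.
Qed.

Lemma continuous_principal_arg (R : realType) (f g : R -> R) (t : R) :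
  0 < Num.sqrt (f t ^+ 2 + g t ^+ 2) + f t ->
  {for t, continuous f} -> {for t, continuous g} ->
  {for t, continuous (fun s => principal_arg (f s) (g s))}.
Proof.
move=> slit fc gc; apply: cvgM; first exact: cvg_cst.
apply: continuous_cvg; first exact: continuous_atan.
apply: cvgM => //; apply: cvgV; first exact: lt0r_neq0.
apply: cvgD => //; apply: continuous_cvg; first exact: sqrt_continuous.
by apply: cvgD; [exact: (cvgM fc fc)|exact: (cvgM gc gc)].
Qed.

Lemma principal_argN (R : realType) (x y : R) :
  principal_arg x (- y) = - principal_arg x y.
Proof. by rewrite /principal_arg sqrrN mulNr atanN mulrN. Qed.

Lemma principal_arg_cvgy (R : realType) (r : R) : 0 <= r ->
  principal_arg r y @[y --> +oo] --> pi / 2.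
Proof.
move=> r0.
have -> : pi / 2 = 2 * atan 1 :> R by rewrite atan1; field.
apply: cvgM; first exact: cvg_cst.
apply: continuous_cvg; first exact: continuous_atan.
apply/cvgrPdist_lt => e e0; near=> y.
have y0 : 0 < y by near: y; apply: nbhs_pinfty_gt; exact: num_real.
(* The ratio differs from 1 by at most 2 r / y. *)
have ye : 2 * r / e < y by near: y; apply: nbhs_pinfty_gt; exact: num_real.
set S := Num.sqrt _.
have Sy : y <= S.
  rewrite -(ger0_norm (ltW y0)) -sqrtr_sqr ler_sqrt ?lerDr ?sqr_ge0 //.
  by rewrite addr_ge0 ?sqr_ge0.
have Syr : S <= y + r.
  rewrite -(ger0_norm (addr_ge0 (ltW y0) r0)) -sqrtr_sqr ler_sqrt ?sqr_ge0 //.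
  by have := mulr_ge0 r0 (ltW y0); nra.
have Sr : 0 < S + r by lra.
have -> : 1 - y / (S + r) = (S + r - y) / (S + r).
  by field; exact: lt0r_neq0.
rewrite ger0_norm; last by apply: divr_ge0; lra.
rewrite ltr_pdivrMr //.
move: ye; rewrite ltr_pdivrMr // mulrC => ye.
have : e * y <= e * (S + r) by rewrite ler_pM2l //; lra.
by lra.
Unshelve. all: by end_near. Qed.

Lemma principal_arg_shift_cvgy (R : realType) (r m : R) : 0 <= r ->
  principal_arg r (y - m) @[y --> +oo] --> pi / 2.
Proof.
move=> r0; apply: cvg_comp (principal_arg_cvgy r0); exact: cvg_addrr.
Qed.

Lemma principal_arg_shift_cvgNy (R : realType) (r m : R) : 0 <= r ->
  principal_arg r (y - m) @[y --> -oo] --> - (pi / 2).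
Proof.
move=> r0; apply/cvgNy_compNP.
have -> : (fun y => principal_arg r (y - m)) \o -%R =
    (fun y => - principal_arg r (y - - m)).
  by apply/funext => y /=; rewrite -principal_argN opprB addrC.
by apply: cvgN; exact: principal_arg_shift_cvgy.
Qed.

(** * Continuous functions on the extended real line *)

Definition extend_line (R : realType) (g : R -> R) (l r : R) (w : \bar R) : R :=
  match w with
  | EFin x => g x
  | +oo%E => r
  | -oo%E => l
  end.

Lemma continuous_extend_line (R : realType) (g : R -> R) (l r : R) :
  continuous g -> g x @[x --> -oo] --> l -> g x @[x --> +oo] --> r ->
  continuous (extend_line g l r).
Proof.
move=> gc gl gr w; apply/(@cvgrPdist_lt _ _ _ (nbhs w)) => e e0; case: w => [x||].
- by apply/nbhs_EFin; exact: cvgr_dist_lt (gc x) _ e0.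
- by apply/nbhs_ereal_pinfty; split;
     [rewrite /= subrr normr0|exact: cvgr_dist_lt gr _ e0].
- by apply/nbhs_ereal_ninfty; split;
     [rewrite /= subrr normr0|exact: cvgr_dist_lt gl _ e0].
Qed.

Lemma continuous_ereal_restr (R : realType) (t : \bar R -> R) :
  continuous t ->
  [/\ continuous (fun x : R => t x%:E),
      t x%:E @[x --> -oo] --> t -oo%E &
      t x%:E @[x --> +oo] --> t +oo%E].
Proof.
move=> tc; split.
- move=> x; apply/cvgrPdist_lt => e e0.
  by have /(@cvgrPdist_lt _ _ _ (nbhs x%:E))/(_ e e0) := tc x%:E.
- apply/cvgrPdist_lt => e e0.
  have /(@cvgrPdist_lt _ _ _ (nbhs -oo%E))/(_ e e0) := tc -oo%E.
  by move=> /nbhs_ereal_ninfty[].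
- apply/cvgrPdist_lt => e e0.
  have /(@cvgrPdist_lt _ _ _ (nbhs +oo%E))/(_ e e0) := tc +oo%E.
  by move=> /nbhs_ereal_pinfty[].
Qed.

Lemma near_infty_norm (R : realType) (M : R) :
  (\forall x \near +oo, M <= `|x|) /\ (\forall x \near -oo, M <= `|x|).
Proof.
split; near=> x.
- rewrite (le_trans _ (ler_norm _)) //; near: x;
  apply: nbhs_pinfty_ge; exact: num_real.
- rewrite -normrN (le_trans _ (ler_norm _)) // lerNr; near: x.
  apply: nbhs_ninfty_le; exact: num_real.
Unshelve. all: by end_near. Qed.

(** * The argument of z - a along a path following the imaginary axis *)

Definition axis_contour (R : realType) (C : R -> R[i]) : Prop :=
  [/\ continuous (fun x => complex.Re (C x)),
      continuous (fun x => complex.Im (C x)) &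
      exists M, forall x, M <= `|x| -> C x = 0 +i* x].

(** The condition on points outside the open right half plane is weak enough to
    allow points of the imaginary axis itself, around which the path is
    indented. *)
Definition keeps_side (R : realType) (C : R -> R[i]) (a : R[i]) : Prop :=
  forall x, if 0 < complex.Re a then complex.Re (C x) < complex.Re a
            else (0 <= complex.Re (C x)) && (C x != a).

(** Seen from the path, a point a on its left is such that z - a stays in the
    closed right half plane minus 0, where the principal argument of z - a is
    continuous; for a point on the right, a - z stays there, and pi is added
    to its principal argument.  Both determinations end at pi / 2. *)
Lemma arg_along_contour (R : realType) (C : R -> R[i]) (a : R[i]) :
  axis_contour C -> keeps_side C a ->
  exists theta : \bar R -> R,
    [/\ continuous theta,
        forall x : R, is_arg (C x - a) (theta x%:E),
        theta +oo%E = pi / 2 &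
        theta -oo%E = - (pi / 2) + 2 * pi * (0 < complex.Re a)%R%:R].
Proof.
case: a => ax ay /= [cxc cyc [M CM']]; rewrite /keeps_side /= => side.
pose cx x := complex.Re (C x); pose cy x := complex.Im (C x).
have CE x : C x = cx x +i* cy x by rewrite /cx /cy; case: (C x).
have CM x : M <= `|x| -> cx x = 0 /\ cy x = x.
  by move=> /CM'; rewrite /cx /cy => ->.
have left : ax <= 0 -> forall x, 0 <= cx x /\ cx x +i* cy x != ax +i* ay.
  by move=> a0 x; have := side x; rewrite ltNge a0 /= -CE => /andP.
have right : 0 < ax -> forall x, cx x < ax.
  by move=> a0 x; have := side x; rewrite a0.
suff [t [tc ta ty tNy]] : exists theta : \bar R -> R,
    [/\ continuous theta,
        forall x : R, is_arg (cx x +i* cy x - (ax +i* ay)) (theta x%:E),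
        theta +oo%E = pi / 2 &
        theta -oo%E = - (pi / 2) + 2 * pi * (0 < ax)%R%:R].
  by exists t; split=> // x; rewrite CE; exact: ta.
have [a0|a0] := ltP 0 ax; last first.
- have slit x : 0 < Num.sqrt ((cx x - ax) ^+ 2 + (cy x - ay) ^+ 2) + (cx x - ax).
    have [c0 ne] := left a0 x.
    have d0 : 0 <= cx x - ax by lra.
    rewrite lt_neqAle addr_ge0 ?sqrtr_ge0 // andbT eq_sym.
    apply: contraNN ne; rewrite paddr_eq0 ?sqrtr_ge0 // => /andP[+ /eqP d].
    rewrite d expr0n /= add0r sqrtr_sqr normr_eq0 => d'.
    by rewrite eq_complex /= -subr_eq0 d eqxx -subr_eq0.
  have far F : Filter F -> (\forall x \near F, M <= `|x|) ->
      {near F, (fun x => principal_arg (- ax) (x - ay)) =1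
               (fun x => principal_arg (cx x - ax) (cy x - ay))}.
    by move=> FF; apply: filterS => x /CM[-> ->]; rewrite sub0r.
  have r0 : 0 <= - ax by lra.
  have [My MNy] := near_infty_norm M.
  exists (extend_line (fun x => principal_arg (cx x - ax) (cy x - ay))
    (- (pi / 2)) (pi / 2)); split => //=; last by rewrite mulr0 addr0.
  + apply: continuous_extend_line.
    * move=> x; apply: (@continuous_principal_arg _ (fun s => cx s - ax)
        (fun s => cy s - ay)) => //.
        by apply: cvgB; [exact: cxc|exact: cvg_cst].
      by apply: cvgB; [exact: cyc|exact: cvg_cst].
    * apply: cvg_trans (@principal_arg_shift_cvgNy R _ ay r0).
      by apply: near_eq_cvg; exact: far.
    * apply: cvg_trans (@principal_arg_shift_cvgy R _ ay r0).
      by apply: near_eq_cvg; exact: far.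
  + by move=> x; exact: principal_argP.
- have slit x : 0 < Num.sqrt ((ax - cx x) ^+ 2 + (ay - cy x) ^+ 2) + (ax - cx x).
    by rewrite ltr_wpDl ?sqrtr_ge0 // subr_gt0 right.
  have far F : Filter F -> (\forall x \near F, M <= `|x|) ->
      {near F, (fun x => pi - principal_arg ax (x - ay)) =1
               (fun x => pi + principal_arg (ax - cx x) (ay - cy x))}.
    move=> FF; apply: filterS => x /CM[-> ->].
    by rewrite subr0 -principal_argN opprB.
  have [My MNy] := near_infty_norm M.
  exists (extend_line (fun x => pi + principal_arg (ax - cx x) (ay - cy x))
    (pi + pi / 2) (pi / 2)); split => //=; last by field.
  + apply: continuous_extend_line.
    * move=> x; apply: cvgD; first exact: cvg_cst.
      apply: (@continuous_principal_arg _ (fun s => ax - cx s)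
        (fun s => ay - cy s)) => //.
        by apply: cvgB; [exact: cvg_cst|exact: cxc].
      by apply: cvgB; [exact: cvg_cst|exact: cyc].
    * rewrite -[pi / 2]opprK.
      apply: cvg_trans (cvgB (cvg_cst pi)
        (@principal_arg_shift_cvgNy R _ ay (ltW a0))).
      by apply: near_eq_cvg; exact: far.
    * have -> : pi / 2 = pi - pi / 2 :> R by field.
      apply: cvg_trans (cvgB (cvg_cst pi)
        (@principal_arg_shift_cvgy R _ ay (ltW a0))).
      by apply: near_eq_cvg; exact: far.
  + move=> x; have := principal_argP (slit x).
    rewrite /is_arg expiD => e.
    have -> : cx x +i* cy x - (ax +i* ay) = - ((ax - cx x) +i* (ay - cy x)).
      by apply/eqP; rewrite eq_complex /= !opprB !eqxx.
    rewrite normrN {1}e [RHS]mulrCA -mulN1r; congr (_ * _).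
    by rewrite /expi cospi sinpi; apply/eqP; rewrite eq_complex /= oppr0 !eqxx.
Qed.

Lemma arg_prod_along_contour (R : realType) (C : R -> R[i]) (s : seq R[i]) :
  axis_contour C -> (forall a, a \in s -> keeps_side C a) ->
  exists theta : \bar R -> R,
    [/\ continuous theta,
        forall x : R, is_arg (\prod_(a <- s) (C x - a)) (theta x%:E),
        theta +oo%E = (size s)%:R * (pi / 2) &
        theta -oo%E = - ((size s)%:R * (pi / 2)) +
          2 * pi * (count (fun a => 0 < complex.Re a) s)%:R].
Proof.
move=> CC; elim: s => [|a s IH] side.
  exists (fun=> 0); split; rewrite ?mul0r ?oppr0 ?mulr0 ?addr0 //.
    exact: cst_continuous.
  by move=> x; rewrite /is_arg big_nil normr1 expi0 mulr1.
have [|t1 [t1c t1a t1y t1Ny]] := @arg_along_contour _ _ a CC.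
  by apply: side; rewrite mem_head.
have [b bs|t2 [t2c t2a t2y t2Ny]] := IH.
  by apply: side; rewrite inE bs orbT.
exists (fun w => t1 w + t2 w); split.
- by move=> w; apply: cvgD; [exact: t1c|exact: t2c].
- by move=> x; rewrite big_cons; exact: is_argM.
- by rewrite t1y t2y /= -[(size s).+1%:R]natr1; ring.
- by rewrite t1Ny t2Ny /= natrD -[(size s).+1%:R]natr1; ring.
Qed.

(** * The winding number of a ratio of products *)

(** The arguments of numerator and denominator agree at +oo, since there are as
    many factors; at -oo they differ by 2 pi for each factor vanishing in the
    right half plane. *)
Lemma winding_number_ratio (R : realType) (C : R -> R[i]) (zs ps : seq R[i])
    (g : \bar R -> R[i]) (s : R[i]) :
  axis_contour C -> (forall a, a \in zs -> keeps_side C a) ->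
  (forall a, a \in ps -> keeps_side C a) -> size zs = size ps -> s != 0 ->
  g +oo%E = 0 -> g -oo%E = 0 ->
  (forall x : R, g x%:E - s =
     - s * (\prod_(a <- zs) (C x - a) / \prod_(a <- ps) (C x - a))) ->
  winding_number g s ((count (fun a => 0 < complex.Re a) ps)%:Z -
                      (count (fun a => 0 < complex.Re a) zs)%:Z).
Proof.
move=> CC zsides psides szs s0 gy gNy gE; set P := fun _ => _.
have ne0 r x : (forall a, a \in r -> keeps_side C a) ->
    \prod_(a <- r) (C x - a) != 0.
  move=> sides; rewrite prodf_seq_neq0; apply/allP => a /sides /(_ x) /=.
  case: ifP => [_ lt|_ /andP[_ ne]]; rewrite subr_eq0 //.
  by apply: contraTneq lt => ->; rewrite ltxx.
split.
  move=> [x||]; rewrite -subr_eq0 ?gy ?gNy ?sub0r ?oppr_eq0 //.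
  by rewrite gE mulf_neq0 ?oppr_eq0 ?mulf_neq0 ?invr_eq0 ?ne0.
have [t0 t0a] := exists_arg (- s).
have [t1 [t1c t1a t1y t1Ny]] := arg_prod_along_contour CC zsides.
have [t2 [t2c t2a t2y t2Ny]] := arg_prod_along_contour CC psides.
exists (fun w => t0 + (t1 w - t2 w)); split.
- move=> w; apply: cvgD; first exact: cvg_cst.
  by apply: cvgB; [exact: t1c|exact: t2c].
- move=> [x||].
  + by rewrite gE; apply: is_argM => //; apply: is_argM => //; exact: is_argV.
  + by rewrite gy sub0r t1y t2y szs subrr addr0.
  + rewrite gNy sub0r t1Ny t2Ny szs.
    set k := count P zs; set l := count P ps.
    have -> : t0 + (- ((size ps)%:R * (pi / 2)) + 2 * pi * k%:R -
        (- ((size ps)%:R * (pi / 2)) + 2 * pi * l%:R)) =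
      t0 + (2 * pi * k%:R - 2 * pi * l%:R) by ring.
    by rewrite !expiD expiN !expi_2pi_nat invr1 !mulr1.
- by rewrite t1y t2y t1Ny t2Ny szs intrD mulrNz -!pmulrn -/P; ring.
Qed.

(** If d took two values, it would take a value strictly less than pi above the
    smaller one, where the cosine is not 1. *)
Lemma expi1_constant (R : realType) (d : R -> R) :
  continuous d -> (forall x, expi (d x) = 1) -> forall x y, d x = d y.
Proof.
move=> dc d1 x y; wlog xy : x y / x <= y.
  by move=> W; have [/W//|/ltW/W//] := leP x y.
apply/eqP/negPn/negP => ne.
pose lo := Num.min (d x) (d y); pose hi := Num.max (d x) (d y).
have lohi : lo < hi by rewrite /lo /hi; case: (ltgtP (d x) (d y)) ne.
have lo1 : expi lo = 1 by rewrite /lo; case: leP.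
pose h := Num.min (hi - lo) pi / 2.
have pi0 := pi_gt0 R.
have [h0 hhi hpi] : [/\ 0 < h, lo + h <= hi & h < pi].
  by rewrite /h; case: (leP (hi - lo) pi) => ?; split; lra.
have [|c _ dcE] := @IVT _ d x y (lo + h) xy (continuous_subspaceT dc).
  by rewrite -/lo -/hi hhi lerDl ltW.
have := d1 c; rewrite dcE expiD lo1 mul1r => -[ch _].
have : h = 0 by apply: cos_inj; rewrite ?in_itv /= ?cos0 // ?lexx ?ltW.
by move/eqP; rewrite gt_eqF.
Qed.

(** Two determinations of the argument differ by a continuous function with
    values in 2 pi Z, which is constant on the real line, hence up to both
    ends. *)
Lemma winding_number_uniq (R : realType) (g : \bar R -> R[i]) (s : R[i])
    (m m' : int) :
  winding_number g s m -> winding_number g s m' -> m = m'.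
Proof.
move=> [gs [t [/continuous_ereal_restr[tc tNy ty] ta tm]]].
move=> [_ [t' [/continuous_ereal_restr[t'c t'Ny t'y] t'a t'm]]].
pose d (x : R) := t x%:E - t' x%:E.
have dc : continuous d by move=> x; apply: cvgB; [exact: tc|exact: t'c].
have d1 x : expi (d x) = 1.
  have n0 : `|g x%:E - s| != 0 by rewrite normr_eq0 subr_eq0.
  rewrite /d expiD expiN; have := ta x%:E; rewrite {1}t'a => /(mulfI n0) <-.
  rewrite mulfV //; apply: contraNneq n0 => e0.
  by rewrite normr_eq0 t'a e0 mulr0.
have dcst : d = cst (d 0) by apply/funext => x; exact: expi1_constant.
have Ey : t +oo%E - t' +oo%E = d 0.
  have : d x @[x --> +oo] --> t +oo%E - t' +oo%E by exact: cvgB ty t'y.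
  rewrite dcst => dl; apply: (cvg_unique _ dl); first exact: Rhausdorff.
  exact: cvg_cst.
have ENy : t -oo%E - t' -oo%E = d 0.
  have : d x @[x --> -oo] --> t -oo%E - t' -oo%E by exact: cvgB tNy t'Ny.
  rewrite dcst => dl; apply: (cvg_unique _ dl); first exact: Rhausdorff.
  exact: cvg_cst.
have : 2 * pi * m%:~R = 2 * pi * m'%:~R :> R by rewrite -tm -t'm; lra.
have pi0 : 2 * pi != 0 :> R by rewrite mulf_neq0 ?lt0r_neq0 ?pi_gt0.
by move=> /(mulfI pi0) /intr_inj.
Qed.

(** * The indented imaginary axis *)

(** The path whose image under f is the indented curve of f, when ws lists the
    imaginary poles of f. *)
Definition indented_axis (R : realType) (ws : seq R) (e x : R) : R[i] :=
  match [seq w <- ws | `|x - w| < e] with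
  | w :: _ => (0 +i* w) + e%:C * expi (pi / (2 * e) * (x - w))
  | [::] => 0 +i* x
  end.

Lemma indented_curveE (R : realType) (f : {fraction {poly R[i]}}) (e x : R) :
  indented_curve f e x%:E = rat_eval f (indented_axis (imag_poles f) e x).
Proof. by rewrite /indented_curve /indented_axis; case: [seq w <- _ | _]. Qed.

(** An indentation stays strictly to the right of the axis: the angle it is
    parametrized by ranges over the open interval from - pi / 2 to pi / 2. *)
Variant indented_axis_spec (R : realType) (ws : seq R) (e x : R) : R[i] -> Prop :=
  | OnAxis of (forall w, w \in ws -> e <= `|x - w|) :
      indented_axis_spec ws e x (0 +i* x)
  | OnIndent w of w \in ws & `|x - w| < e &
      0 < cos (pi / (2 * e) * (x - w)) :
      indented_axis_spec ws e x
        ((e * cos (pi / (2 * e) * (x - w))) +i*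
         (w + e * sin (pi / (2 * e) * (x - w)))).

Lemma indented_axisP (R : realType) (ws : seq R) (e x : R) :
  indented_axis_spec ws e x (indented_axis ws e x).
Proof.
rewrite /indented_axis; case E: [seq w <- ws | _] => [|w s].
  constructor=> w wws; rewrite leNgt; apply/negP => lt.
  have : w \in [seq w <- ws | `|x - w| < e] by rewrite mem_filter lt.
  by rewrite E.
have : w \in [seq w <- ws | `|x - w| < e] by rewrite E mem_head.
rewrite mem_filter => /andP[xw wws].
have -> : (0 +i* w) + e%:C * expi (pi / (2 * e) * (x - w)) =
    (e * cos (pi / (2 * e) * (x - w))) +i* (w + e * sin (pi / (2 * e) * (x - w))).
  by apply/eqP; rewrite eq_complex /=; apply/andP; split; apply/eqP; ring.
have e0 : 0 < e by apply: le_lt_trans xw; exact: normr_ge0.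
have pi0 := pi_gt0 R.
constructor => //; apply: cos_gt0_pihalf; rewrite -ltr_norml normrM.
have -> : pi / 2 = `|pi / (2 * e)| * e.
  rewrite ger0_norm ?divr_ge0 ?mulr_ge0 ?ltW //; field; exact: lt0r_neq0.
by rewrite ltr_pM2l // normr_gt0 mulf_neq0 ?invr_eq0 ?mulf_neq0 ?lt0r_neq0.
Qed.

Definition clamp (R : realType) (e t : R) : R := Num.max (- e) (Num.min e t).

Lemma continuous_clamp (R : realType) (e : R) : continuous (clamp e).
Proof.
apply: (@max_fun_continuous _ R R (cst (- e)) (cst e \min id)).
  exact: cst_continuous.
apply: (@min_fun_continuous _ R R (cst e) id); first exact: cst_continuous.
by move=> t; exact: cvg_id.
Qed.

Lemma clamp_id (R : realType) (e t : R) : `|t| < e -> clamp e t = t.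
Proof.
by rewrite ltr_norml => /andP[l r]; rewrite /clamp min_r ?max_r ?ltW.
Qed.

Lemma clamp_far (R : realType) (e t : R) : 0 < e -> e <= `|t| ->
  clamp e t = e \/ clamp e t = - e.
Proof.
move=> e0; rewrite ler_normr /clamp => /orP[et|et]; [left|right].
  by rewrite min_l // max_r //; lra.
by rewrite min_r ?max_l //; lra.
Qed.

(** Clamping t = x - w to [- e, e] makes the two parts of the deviation of the half
    circle around i w from the axis vanish off the indentation, without a case
    distinction. *)
Definition bump_re (R : realType) (e t : R) : R :=
  e * cos (pi / (2 * e) * clamp e t).

Definition bump_im (R : realType) (e t : R) : R :=
  e * sin (pi / (2 * e) * clamp e t) - clamp e t.

Lemma bump_far (R : realType) (e t : R) : 0 < e -> e <= `|t| ->
  bump_re e t = 0 /\ bump_im e t = 0.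
Proof.
move=> e0 /(clamp_far e0); rewrite /bump_re /bump_im.
have E : pi / (2 * e) * e = pi / 2 by field; exact: lt0r_neq0.
by case=> ->; rewrite ?mulrN E ?cosN ?sinN cos_pihalf sin_pihalf mulr0;
   split => //; ring.
Qed.

(** With disjoint indentations at most one term of each sum is nonzero.  This
    form of the path makes its continuity evident; duplicates in ws are removed
    so that no indentation is counted twice. *)
Lemma indented_axisE (R : realType) (ws : seq R) (e x : R) : 0 < e ->
  (forall w w', w \in ws -> w' \in ws -> w != w' -> 2 * e <= `|w - w'|) ->
  indented_axis ws e x =
    (\sum_(w <- undup ws) bump_re e (x - w)) +i*
    (x + \sum_(w <- undup ws) bump_im e (x - w)).
Proof.
move=> e0 sep; case: indented_axisP => [far|w wws xw _].
  by rewrite !big1_seq ?addr0 // => w /=;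
     rewrite mem_undup => /far /(bump_far e0)[].
have far w' : w' \in undup ws -> w' != w -> e <= `|x - w'|.
  rewrite mem_undup => w's ne; have := sep _ _ wws w's.
  rewrite eq_sym ne => /(_ isT).
  have -> : w - w' = (x - w') - (x - w) by ring.
  by move=> sep'; have := ler_normB (x - w') (x - w); lra.
rewrite !(bigD1_seq w) ?mem_undup ?undup_uniq //= !big1_seq.
- by rewrite /bump_re /bump_im clamp_id //; congr (_ +i* _); ring.
- by move=> w' /andP[w'w /far /(_ w'w) /(bump_far e0)[]].
- by move=> w' /andP[w'w /far /(_ w'w) /(bump_far e0)[]].
Qed.

Lemma axis_contour_indented (R : realType) (ws : seq R) (e : R) : 0 < e ->
  (forall w w', w \in ws -> w' \in ws -> w != w' -> 2 * e <= `|w - w'|) ->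
  axis_contour (indented_axis ws e).
Proof.
move=> e0 sep.
have kc (w : R) : continuous (fun x => clamp e (x - w)).
  move=> x; apply: continuous_cvg; first exact: continuous_clamp.
  by apply: cvgB; [exact: cvg_id|exact: cvg_cst].
have ac (w : R) : continuous (fun x => pi / (2 * e) * clamp e (x - w)).
  by move=> x; apply: cvgM; [exact: cvg_cst|exact: kc].
split.
- have -> : (fun x => complex.Re (indented_axis ws e x)) =
      (fun x => \sum_(w <- undup ws) bump_re e (x - w)).
    by apply/funext => x; rewrite indented_axisE.
  move=> x; apply: cvg_big => [|w _]; first exact: add_continuous.
  apply: cvgM; first exact: cvg_cst.
  by apply: continuous_cvg; [exact: continuous_cos|exact: ac].
- have -> : (fun x => complex.Im (indented_axis ws e x)) =
      (fun x => x + \sum_(w <- undup ws) bump_im e (x - w)).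
    by apply/funext => x; rewrite indented_axisE.
  move=> x; apply: cvgD; first exact: cvg_id.
  apply: cvg_big => [|w _]; first exact: add_continuous.
  apply: cvgB; last exact: kc.
  apply: cvgM; first exact: cvg_cst.
  by apply: continuous_cvg; [exact: continuous_sin|exact: ac].
- exists (e + \sum_(w <- ws) `|w|) => x xM; case: indented_axisP => // w wws xw.
  have wS : `|w| <= \sum_(w <- ws) `|w|.
    by rewrite (big_rem w) //= lerDl sumr_ge0.
  by exfalso; have := ler_normD (x - w) w; rewrite subrK; lra.
Qed.

(** The indentations go to the right by at most e, and go around the points of
    the axis listed in ws. *)
Lemma keeps_side_indented (R : realType) (ws : seq R) (e : R) (a : R[i]) :
  0 < e ->
  (0 < complex.Re a -> e < complex.Re a) ->
  (complex.Re a = 0 -> complex.Im a \in ws) ->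
  keeps_side (indented_axis ws e) a.
Proof.
case: a => ax ay /= e0 right onaxis x /=.
case: indented_axisP => [far|w wws xw c0] /=.
  case: ltP => // ax0; rewrite lexx eq_complex /= negb_and.
  case: eqP => // ax0'; apply: contraTneq e0 => xay.
  by have := far _ (onaxis (esym ax0')); rewrite xay subrr normr0 leNgt.
have ec : 0 < e * cos (pi / (2 * e) * (x - w)) by rewrite mulr_gt0.
case: ltP => ax0.
  apply: le_lt_trans (right ax0); rewrite ger_pMr //; exact: cos_le1.
by rewrite ltW //= eq_complex /= negb_and gt_eqF //; lra.
Qed.

Lemma near_all_seq (U : Type) (V : eqType) (F : set_system U)
    (P : V -> U -> Prop) (s : seq V) :
  Filter F -> (forall a, a \in s -> \forall e \near F, P a e) ->
  \forall e \near F, forall a, a \in s -> P a e.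
Proof.
move=> FF; elim: s => [|b s IH] H; first by near=> e.
have Hb := H b (mem_head _ _).
have Hs := IH (fun a as_ => H a (mem_behead (s := b :: s) as_)).
by apply: filterS2 Hb Hs => e Pb Ps a; rewrite inE => /orP[/eqP->|/Ps].
Unshelve. all: by end_near. Qed.

(** * The index of the Nyquist curve *)

Lemma nyquist_index_winding (R : realType) (f : {fraction {poly R[i]}})
    (s : R[i]) (m : int) :
  nyquist_index f s m ->
  \forall e \near 0^'+, exists k, winding_number (indented_curve f e) s k.
Proof.
rewrite /nyquist_index; case E: (imag_poles f) => [|w ws].
  move=> W; near=> e; exists m.
  have -> : indented_curve f e = nyquist_curve f; last exact: W.
  by apply/funext => -[x||] //; rewrite /indented_curve E.
by move=> [ind [W _]]; apply: filterS W => e We; exists (ind e).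
Unshelve. all: by end_near. Qed.

Lemma nyquist_index_near (R : realType) (f : {fraction {poly R[i]}})
    (s : R[i]) (m k : int) :
  (\forall e \near 0^'+, winding_number (indented_curve f e) s k) ->
  nyquist_index f s m <-> m = k.
Proof.
move=> W; rewrite /nyquist_index; case E: (imag_poles f) => [|w ws].
  have Wk : winding_number (nyquist_curve f) s k.
    near (0 : R)^'+ => e.
    have <- : indented_curve f e = nyquist_curve f; last by near: e.
    by apply/funext => -[x||] //; rewrite /indented_curve E.
  by split=> [Wm|-> //]; exact: winding_number_uniq Wm Wk.
split=> [[ind [Wi lim]]|->].
  have indk : \forall e \near 0^'+, ((ind e)%:~R : R) = k%:~R.
    by apply: filterS2 W Wi => e Wk Wi; rewrite (winding_number_uniq Wk Wi).
  have lk : (ind e)%:~R @[e --> 0^'+] --> (k%:~R : R).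
    exact: cvg_near_cst.
  have : (m%:~R : R) = k%:~R by apply: (cvg_unique _ lim lk); exact: Rhausdorff.
  exact: intr_inj.
by exists (fun=> k); split => //; exact: cvg_cst.
Unshelve. all: by end_near. Qed.

(** For small e the indented axis has disjoint indentations, and stays on the
    left of all zeros and poles in the open right half plane. *)
Lemma near_winding_number (R : realType) (f : {fraction {poly R[i]}})
    (s : R[i]) (zs : seq R[i]) :
  s != 0 -> size zs = size (poles f) ->
  (forall z, z \notin poles f -> rat_eval f z - s =
     - s * (\prod_(a <- zs) (z - a) / \prod_(a <- poles f) (z - a))) ->
  (forall a, a \in zs -> complex.Re a != 0) ->
  \forall e \near 0^'+, winding_number (indented_curve f e) s
    ((num_unstable_poles f)%:Z - (count (fun a => 0 < complex.Re a) zs)%:Z).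
Proof.
move=> s0 szs fE zs0.
have right : \forall e \near (0 : R)^'+, forall a, a \in zs ++ poles f ->
    0 < complex.Re a -> e < complex.Re a.
  apply: near_all_seq => a _; have [a0|a0] := ltP 0 (complex.Re a).
    by near=> e => _; near: e; exact: nbhs_right_lt.
  by near=> e.
have sep : \forall e \near (0 : R)^'+, forall w, w \in imag_poles f ->
    forall w', w' \in imag_poles f -> w != w' -> 2 * e <= `|w - w'|.
  apply: near_all_seq => w _; apply: near_all_seq => w' _.
  have [->|ne] := eqVneq w w'; first by near=> e.
  near=> e => _; rewrite mulrC -ler_pdivlMr //; near: e; apply: nbhs_right_le.
  by rewrite divr_gt0 // normr_gt0 subr_eq0.
near=> e.
have e0 : 0 < e by near: e; exact: nbhs_right_gt.
have R1 : forall a, a \in zs ++ poles f -> 0 < complex.Re a -> e < complex.Re a.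
  by near: e.
have S1 : forall w, w \in imag_poles f ->
    forall w', w' \in imag_poles f -> w != w' -> 2 * e <= `|w - w'|.
  by near: e.
have zside a : a \in zs -> keeps_side (indented_axis (imag_poles f) e) a.
  move=> az; apply: keeps_side_indented => //.
    by apply: R1; rewrite mem_cat az.
  by move/eqP; rewrite (negPf (zs0 a az)).
have pside a : a \in poles f -> keeps_side (indented_axis (imag_poles f) e) a.
  move=> ap; apply: keeps_side_indented => //.
    by apply: R1; rewrite mem_cat ap orbT.
  by move/eqP => a0; apply/mapP; exists a; rewrite // mem_filter a0.
apply: (winding_number_ratio _ zside pside szs s0) => //.
  by apply: axis_contour_indented => // w w' ww w'w; exact: S1.
move=> x; rewrite indented_curveE fE //.
apply/negP => /pside /(_ x); case: ifP; rewrite ?ltxx //.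
by rewrite eqxx andbF.
Unshelve. all: by end_near. Qed.

(** For small e the indentations avoid z, so that z itself is on the indented
    axis and s on the indented curve. *)
Lemma value_on_axis_no_index (R : realType) (f : {fraction {poly R[i]}})
    (s z : R[i]) (m : int) :
  complex.Re z = 0 -> z \notin poles f -> rat_eval f z = s ->
  ~ nyquist_index f s m.
Proof.
case: z => x y /= -> {x} zp fz /nyquist_index_winding W.
have far : \forall e \near (0 : R)^'+, forall w, w \in imag_poles f ->
    e <= `|y - w|.
  apply: near_all_seq => w /mapP[a]; rewrite mem_filter => /andP[/eqP a0 ap] ->.
  near=> e; near: e; apply: nbhs_right_le; rewrite normr_gt0 subr_eq0.
  by apply: contraNneq zp => ->; rewrite -a0; case: a ap {a0}.
near (0 : R)^'+ => e.
have [k [gs _]] : exists k, winding_number (indented_curve f e) s k by near: e.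
have farE : forall w, w \in imag_poles f -> e <= `|y - w| by near: e.
have := gs y%:E; rewrite indented_curveE.
case: indented_axisP => [_|w wws]; first by rewrite fz eqxx.
by rewrite ltNge farE.
Unshelve. all: by end_near. Qed.

(** * The transfer function in lowest terms *)

Lemma tofrac_repr (D : idomainType) (f : {fraction D}) :
  f * tofrac (frac (repr f)).2 = tofrac (frac (repr f)).1.
Proof.
rewrite -{1}[f]reprK; move: (repr f) => x; have x2 := denom_ratioP x.
unlock FracField.tofrac; rewrite -[LHS]FracField.pi_mul.
apply/eqmodP; rewrite /= FracField.equivfE /FracField.mulf.
by rewrite !numden_Ratio ?mulf_neq0 ?oner_neq0 // !mulr1 mulrC.
Qed.

(** Two fractions in lowest terms that are equal have proportional numerators
    and denominators. *)
Lemma rat_num_den_coprime (R : realType) (p q : {poly R[i]}) :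
  p != 0 -> coprimep p q ->
  exists2 a : R[i], a != 0 & rat_den (tofrac q / tofrac p) = a *: p /\
    rat_num (tofrac q / tofrac p) = a *: q.
Proof.
move=> p0 cpq; set f := _ / _; rewrite /rat_den /rat_num.
set x := repr f; set d := (frac x).2; set m := (frac x).1.
have d0 : d != 0 by exact: denom_ratioP.
have E : m * p = q * d.
  apply/eqP; rewrite -tofrac_eq !tofracM; apply/eqP.
  have F0 : tofrac p != 0 by rewrite tofrac_eq0.
  by rewrite -(tofrac_repr f) mulrAC divfK.
set g := gcdp m d.
have g0 : g != 0 by rewrite gcdp_eq0 negb_and d0 orbT.
have dE : d = d %/ g * g by rewrite divpK // dvdp_gcdr.
have mE : m = m %/ g * g by rewrite divpK // dvdp_gcdl.
set d' := d %/ g in dE *; set m' := m %/ g in mE *.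
have cdm : coprimep d' m'.
  rewrite coprimep_sym; apply: coprimep_div_gcd; by rewrite d0 orbT.
have E' : m' * p = q * d'.
  by apply: (mulIf g0); rewrite mulrAC -mE E {1}dE mulrA.
have d'0 : d' != 0 by apply: contraNneq d0 => d'0; rewrite dE d'0 mul0r.
have /eqpP[[a1 a2] /= /andP[a10 a20] eqa] : d' %= p.
  apply/andP; split.
    by rewrite -(Gauss_dvdpr _ cdm) E' dvdp_mull.
  by rewrite -(Gauss_dvdpr _ cpq) -E' dvdp_mull.
have d'E : d' = (a2 / a1) *: p.
  by rewrite mulrC -scalerA -eqa scalerA mulVf // scale1r.
exists (a2 / a1); first by rewrite mulf_neq0 ?invr_eq0.
split => //; apply: (mulIf p0); rewrite E' d'E.
by rewrite -scalerAl scalerAr.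
Qed.

Lemma transferE (R : realType) (n : nat) (A : 'M[R]_n) (b : 'cV[R]_n)
    (c : 'rV[R]_n) :
  transfer A b c =
    tofrac (transfer_num (tocomplex A) (tocomplex b) (tocomplex c)) /
    tofrac (char_poly (tocomplex A)).
Proof.
set F := @FracField.tofrac {poly R[i]}.
pose Z := char_poly_mx (tocomplex A).
have ratE k l (M : 'M[R]_(k, l)) : toratfun M =
    map_mx F (map_mx polyC (tocomplex M)).
  by apply/matrixP => i j; rewrite !mxE.
have ZE : (F 'X)%:M - toratfun A = map_mx F Z.
  by rewrite ratE /Z /char_poly_mx map_mxB map_scalar_mx.
rewrite /transfer ZE !ratE.
have detZ : \det (map_mx F Z) = F (char_poly (tocomplex A)) by rewrite det_map_mx.
have detZ0 : \det (map_mx F Z) != 0.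
  by rewrite detZ tofrac_eq0; exact/monic_neq0/char_poly_monic.
rewrite /invmx unitmxE unitfE detZ0 -scalemxAr -scalemxAl mxE detZ.
by rewrite -map_mx_adj -!map_mxM mxE mulrC.
Qed.

Lemma coprimep_minimal (R : realType) (n : nat)
    (A : 'M[R]_n) (b : 'cV[R]_n) (c : 'rV[R]_n) :
  minimal A b c ->
  coprimep (char_poly (tocomplex A))
           (transfer_num (tocomplex A) (tocomplex b) (tocomplex c)).
Proof.
have powE j : tocomplex A ^+ j = tocomplex (A ^+ j).
  elim: j => [|j IH]; first by rewrite !expr0 /tocomplex map_mx1.
  by rewrite !exprS IH -[_ * _]/(_ *m _) -map_mxM.
move=> [ctr obs]; apply: coprimep_char_poly_transfer_num.
- apply: etrans ctr; rewrite -(mxrank_map (real_complex R)); congr mxrank.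
  by apply/matrixP => i j; rewrite [LHS]mxE powE -map_mxM !mxE.
- apply: etrans obs; rewrite -(mxrank_map (real_complex R)); congr mxrank.
  by apply/matrixP => i j; rewrite [LHS]mxE powE -map_mxM !mxE.
Qed.

(** * The Nyquist criterion *)

Lemma horner_prod_XsubC (F : comNzRingType) (r : seq F) (z : F) :
  (\prod_(a <- r) ('X - a%:P)).[z] = \prod_(a <- r) (z - a).
Proof. by rewrite horner_prod; apply: eq_bigr => a _; rewrite hornerXsubC. Qed.

(** Let r = p - s^-1 q, so that f - s = - s r / p, where r and p are monic of the
    same degree because f is strictly proper.  The index of s is p+ - z+ if r
    has no root on the imaginary axis; otherwise s is a value of f on the axis
    and has no index. *)
Lemma nyquist_criterion (R : realType) (p q : {poly R[i]}) (s : R[i]) :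
  p \is monic -> coprimep p q -> (size q < size p)%N -> s != 0 ->
  nyquist_index (tofrac q / tofrac p) s
    (num_unstable_poles (tofrac q / tofrac p))%:Z <->
  forall z, root (p - s^-1 *: q) z -> complex.Re z < 0.
Proof.
move=> pm cpq szq s0; set f := _ / _.
have p0 := monic_neq0 pm.
have [a a0 [denE numE]] := rat_num_den_coprime p0 cpq; rewrite -/f in denE numE.
have evE z : rat_eval f z = q.[z] / p.[z].
  by rewrite /rat_eval denE numE !hornerZ -mulf_div divff // mul1r.
have pE : p = \prod_(z <- poles f) ('X - z%:P).
  have : rat_den f = lead_coef (rat_den f) *: \prod_(z <- poles f) ('X - z%:P).
    exact: svalP (closed_field_poly_normal (rat_den f)).
  by rewrite denE lead_coefZ (eqP pm) mulr1 => /(scalerI a0).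
pose r := p - s^-1 *: q.
have sztq : (size (- (s^-1 *: q)) < size p)%N.
  by rewrite size_polyN; exact: leq_ltn_trans (size_scale_leq _ _) szq.
have rm : r \is monic by rewrite monicE lead_coefDl // -monicE.
have [zs] := closed_field_poly_normal r; rewrite (eqP rm) scale1r => rE.
have szs : size zs = size (poles f).
  have : size r = size p by rewrite size_polyDl.
  by rewrite rE pE !size_prod_XsubC => -[].
have rootr z : root r z = (z \in zs) by rewrite rE root_prod_XsubC.
have fE z : z \notin poles f -> rat_eval f z - s =
     - s * (\prod_(a <- zs) (z - a) / \prod_(a <- poles f) (z - a)).
  rewrite -root_prod_XsubC -pE /root => pz0.
  rewrite -!horner_prod_XsubC -pE -rE evE /r hornerD hornerN hornerZ.
  by field; rewrite s0 pz0.
have onaxis z : z \in zs -> complex.Re z = 0 -> forall m, ~ nyquist_index f s m.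
  move=> zzs z0 m.
  have rz : p.[z] = s^-1 * q.[z].
    apply/eqP; rewrite -subr_eq0.
    by move: zzs; rewrite -rootr /root /r hornerD hornerN hornerZ.
  have pz : p.[z] != 0.
    apply/negP => pz; have qz : root q z.
      by move: pz; rewrite rz mulf_eq0 invr_eq0 (negPf s0).
    by have := coprimep_root cpq pz; rewrite (eqP qz) eqxx.
  apply: (value_on_axis_no_index z0).
    by rewrite -root_prod_XsubC -pE.
  have qz : q.[z] = s * p.[z] by rewrite rz mulrA divff // mul1r.
  by rewrite evE qz mulfK.
split=> [Ns|lhp].
  have zs0 z : z \in zs -> complex.Re z != 0.
    by move=> zzs; apply/eqP => z0; exact: (onaxis z zzs z0 _ Ns).
  have [/(_ Ns) + _] := nyquist_index_near (num_unstable_poles f)%:Z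
    (near_winding_number s0 szs fE zs0).
  move=> /eqP; rewrite eq_sym subr_eq -PoszD eqz_nat -[X in X == _]addn0.
  rewrite eqn_add2l eq_sym -leqn0 leqNgt -has_count => /hasPn rhp z.
  rewrite rootr => zzs; rewrite lt_neqAle zs0 //=.
  by have := rhp z zzs; rewrite -leNgt.
have zs0 z : z \in zs -> complex.Re z != 0.
  by rewrite -rootr => /lhp; exact: ltr0_neq0.
apply/(nyquist_index_near _ (near_winding_number s0 szs fE zs0)).
have -> : count (fun a => 0 < complex.Re a) zs = 0%N.
  by apply/eqP; rewrite -leqn0 leqNgt -has_count; apply/hasPn => z;
     rewrite -rootr => /lhp; rewrite -leNgt; exact: ltW.
by rewrite subr0.
Qed.

Lemma sync_regionE (R : realType) (n : nat)
    (A : 'M[R]_n) (b : 'cV[R]_n) (c : 'rV[R]_n) (k : R) (s : R[i]) :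
  sync_region A b c k s <->
  forall z, root (char_poly (tocomplex A) + (s * k%:C) *:
    transfer_num (tocomplex A) (tocomplex b) (tocomplex c)) z -> complex.Re z < 0.
Proof.
rewrite /sync_region /hurwitz -char_poly_feedback /=.
by split=> H z; have := H z; rewrite eigenvalue_root_char.
Qed.

Theorem lemma3 (R : realType) (n : nat)
    (A : 'M[R]_n) (b : 'cV[R]_n) (c : 'rV[R]_n) :
  minimal A b c ->
  forall k : R, k != 0 ->
    sync_region A b c k `\` [set 0] =
    [set - (1 / (s * k%:C)) | s in stable_nyquist_region A b c `\` [set 0]].
Proof.
move=> mini k k0.
have kC0 : k%:C != 0 by rewrite eq_complex /= eqxx andbT.
have cop := coprimep_minimal mini.
set p := char_poly _ in cop; set q := transfer_num _ _ _ in cop.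
have szq : (size q < size p)%N.
  by rewrite size_char_poly ltnS; exact: size_resolvent_row.
have NE s : s != 0 -> stable_nyquist_region A b c s <->
    forall z, root (p - s^-1 *: q) z -> complex.Re z < 0.
  move=> s0; rewrite /stable_nyquist_region /= transferE.
  by apply: nyquist_criterion => //; exact: char_poly_monic.
apply/seteqP; split => [s [/sync_regionE Ss /eqP s0]|_ [s [Ns /eqP s0] <-]].
  have sk0 : s * k%:C != 0 by rewrite mulf_neq0.
  have t0 : - (s * k%:C)^-1 != 0 by rewrite oppr_eq0 invr_eq0.
  exists (- (s * k%:C)^-1); last by field; rewrite kC0 s0.
  split; last exact/eqP.
  apply/(NE _ t0) => z; rewrite invrN invrK scaleNr opprK; exact: Ss.
split; last by apply/eqP; rewrite oppr_eq0 div1r invr_eq0 mulf_neq0.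
apply/sync_regionE => z.
have -> : - (1 / (s * k%:C)) * k%:C = - s^-1 by field; rewrite kC0 s0.
by rewrite scaleNr; move: z; apply/(NE _ s0).
Qed.
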